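(* Let $\mathcal{C}=\{A_1,\dots,A_L\}$ be a set of real symmetric $m\times m$ matrices. If $\mathcal{C}$ is positive definite, then $\mathcal{C}$ is TWSD-B if and only if it is SD.
   Context: The set $\mathcal{C}$ is called positive definite if some linear combination $\sum_{i=1}^L\alpha_iA_i$ with $\alpha_i\in\mathbb{R}$ is a positive definite matrix. $\mathrm{SL}_m(\mathbb{R})$ is the group of real $m\times m$ matrices with determinant $1$; $\|\cdot\|$ is the Frobenius norm. The set $\mathcal{C}$ is SD if there is $P\in\mathrm{SL}_m(\mathbb{R})$ such that $P^{\mathsf T}A_iP$ is diagonal for all $i$. It is TWSD-B if there exist $P_k\in\mathrm{SL}_m(\mathbb{R})$ and diagonal matrices $D_k^{(1)},\dots,D_k^{(L)}\in\mathbb{R}^{m\times m}$ for $k\ge 1$ such that $\lim_{k\to\infty}\sum_{i=1}^L\|P_kA_iP_k^{\mathsf T}-D_k^{(i)}\|^2=0$ and $\|D_k^{(i)}\|$ is bounded uniformly in $i$ and $k$. *)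

(* Defs.v *)
From HB Require Import structures.
From mathcomp Require Import all_boot all_order all_algebra.
From mathcomp Require Import all_classical all_reals all_analysis.

Set Implicit Arguments.
Unset Strict Implicit.
Unset Printing Implicit Defensive.

Import Order.TTheory GRing.Theory Num.Theory.
Import numFieldNormedType.Exports.

Local Open Scope classical_set_scope.
Local Open Scope ring_scope.

Definition in_SL (R : realType) (m : nat) (P : 'M[R]_m) : Prop := \det P = 1.

(* MathComp-Analysis equips 'M[R]_m with the sup norm, hence the separate
   Frobenius norm. *)
Definition frobenius_norm (R : realType) (m n : nat) (A : 'M[R]_(m, n)) : R :=
  Num.sqrt (\sum_(i < m) \sum_(j < n) A i j ^+ 2).

Definition posdefmx (R : realType) (m : nat) (A : 'M[R]_m) : Prop :=
  A \is symmetricmx /\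
  forall x : 'cV[R]_m, x != 0 -> 0 < (x^T *m A *m x) 0 0.

(* A set {A_1, ..., A_L} is given by its enumeration A : 'I_L -> 'M[R]_m. *)
Definition positive_definite (R : realType) (L m : nat)
    (A : 'I_L -> 'M[R]_m) : Prop :=
  exists a : 'I_L -> R, posdefmx (\sum_(i < L) a i *: A i).

Definition SD (R : realType) (L m : nat) (A : 'I_L -> 'M[R]_m) : Prop :=
  exists2 P : 'M[R]_m, in_SL P & forall i, is_diag_mx (P^T *m A i *m P).

(* The congruence here is P A P^T, while it is P^T A P in SD. Sequences are
   indexed from 0 instead of 1. *)
Definition TWSD_B (R : realType) (L m : nat) (A : 'I_L -> 'M[R]_m) : Prop :=
  exists (P : nat -> 'M[R]_m) (D : nat -> 'I_L -> 'M[R]_m),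
    [/\ forall k, in_SL (P k),
        forall k i, is_diag_mx (D k i),
        (fun k => \sum_(i < L)
           frobenius_norm (P k *m A i *m (P k)^T - D k i) ^+ 2) @ \oo --> (0 : R)
      & exists M : R, forall k i, frobenius_norm (D k i) <= M].

(* Main.v *)
Require Import Defs.
From mathcomp Require Import all_boot all_order all_algebra.
From mathcomp Require Import all_classical all_reals all_analysis.
From mathcomp Require Import lra.

Set Implicit Arguments.
Unset Strict Implicit.
Unset Printing Implicit Defensive.

Import Order.TTheory GRing.Theory Num.Theory.
Import numFieldNormedType.Exports.

Local Open Scope classical_set_scope.
Local Open Scope ring_scope.

(** Simultaneous diagonalizability gives the approximate version with a constant
    sequence.  For the converse, the set of admissible [P k] is not compact in
    general: [SL_m] is unbounded, and a sequence of congruences may diverge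
    while the matrices it produces become diagonal.  Positive definiteness
    prevents this.  If [S = \sum_i a i *: A i] is positive definite, then
    [P k *m S *m (P k)^T] stays bounded, being close to the bounded diagonal
    matrix [\sum_i a i *: D k i].  Its diagonal entries are the values of the
    form [S] at the rows of [P k], and a positive definite form bounds each
    coordinate of its argument ([posdefmx_coord_le]); so the entries of [P k]
    are bounded ([TWSD_B_entry_bounded]).

    By compactness of segments the [P k] then have a limit [Q] along some
    ultrafilter.  Determinants and matrix products are polynomial in the
    entries, hence continuous ([cvg_det_entry], [cvg_mulmx_entry]), so that [Q]
    has determinant 1 and every [Q *m A i *m Q^T] is diagonal: [Q^T]
    diagonalizes the family ([TWSD_B_SD]). *)

(** * Positive definite forms bound coordinates *)

Lemma posdefmx_unit (R : realType) (m : nat) (S : 'M[R]_m) :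
  posdefmx S -> S \in unitmx.
Proof.
move=> [_ Spos]; rewrite -row_free_unit; apply: inj_row_free => v vS0.
apply/eqP; apply: contraT => v0.
have := Spos v^T; rewrite trmxK vS0 mul0mx mxE ltxx.
by apply; rewrite -(inj_eq (@trmx_inj _ _ _)) trmxK trmx0.
Qed.

Lemma posdefmx_ge0 (R : realType) (m : nat) (S : 'M[R]_m) (x : 'cV[R]_m) :
  posdefmx S -> 0 <= (x^T *m S *m x) 0 0.
Proof.
move=> [_ Spos]; have [->|/Spos/ltW //] := eqVneq x 0.
by rewrite mulmx0 mxE.
Qed.

(** A positive definite form controls every coordinate.  With [y] the solution
    of [S y = e_j], the coordinate [x_j] is the [S]-inner product of [x] and
    [y], so that nonnegativity of the form at [x + y] and [x - y] gives
    [2 |x_j| <= q(x) + q(y)].  The constant is [q(y)], which depends on [j]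
    only. *)
Lemma posdefmx_coord_le (R : realType) (m : nat) (S : 'M[R]_m) (j : 'I_m) :
  posdefmx S ->
  exists c : R, forall x : 'cV[R]_m, `|x j 0| *+ 2 <= (x^T *m S *m x) 0 0 + c.
Proof.
move=> pdS; have Su := posdefmx_unit pdS.
have St : S^T = S.
  by have [/is_hermitianmxP] := pdS; rewrite expr0 scale1r map_mx_id.
pose y : 'cV[R]_m := invmx S *m delta_mx j 0.
exists ((y^T *m S *m y) 0 0) => x.
have Sy : S *m y = delta_mx j 0 by rewrite mulmxA mulmxV // mul1mx.
have xSy : (x^T *m S *m y) 0 0 = x j 0.
  by rewrite -mulmxA Sy -colE !mxE.
have ySx : (y^T *m S *m x) 0 0 = x j 0.
  rewrite -[in LHS]St -trmx_mul Sy trmx_delta -rowE !mxE //.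
have := posdefmx_ge0 (x + y) pdS; have := posdefmx_ge0 (x - y) pdS.
rewrite [(x - y)^T]linearB [(x + y)^T]linearD /=.
rewrite !(mulmxDl, mulmxDr, mulNmx, mulmxN).
have addE (B C : 'M[R]_1) : (B + C) 0 0 = B 0 0 + C 0 0 by rewrite mxE.
have oppE (B : 'M[R]_1) : (- B) 0 0 = - B 0 0 by rewrite mxE.
rewrite !(addE, oppE) xSy ySx => hB hD.
by case: (ger0P (x j 0)) => _; rewrite mulr2n; lra.
Qed.

(** * Entries and the Frobenius norm *)

Lemma frobenius_norm_ge0 (R : realType) (m n : nat) (B : 'M[R]_(m, n)) :
  0 <= frobenius_norm B.
Proof. exact: sqrtr_ge0. Qed.

Lemma frobenius_norm_sqr_entry (R : realType) (m n : nat) (B : 'M[R]_(m, n))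
    (i : 'I_m) (j : 'I_n) :
  B i j ^+ 2 <= frobenius_norm B ^+ 2.
Proof.
have row_ge0 k : 0 <= \sum_l B k l ^+ 2 by apply: sumr_ge0 => l _; exact: sqr_ge0.
rewrite sqr_sqrtr; last exact: sumr_ge0.
rewrite (bigD1 i) //= (bigD1 j) //= -addrA lerDl.
by rewrite addr_ge0 // sumr_ge0 // => *; exact: sqr_ge0.
Qed.

Lemma frobenius_norm_entry (R : realType) (m n : nat) (B : 'M[R]_(m, n))
    (i : 'I_m) (j : 'I_n) :
  `|B i j| <= frobenius_norm B.
Proof.
rewrite -(ler_pXn2r (n := 2)) ?nnegrE ?frobenius_norm_ge0 //.
by rewrite real_normK ?num_real // frobenius_norm_sqr_entry.
Qed.

(** * Limits along ultrafilters, entry by entry *)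

(** The maximality of [F] is used in its dichotomy form: a set [B] of a larger
    proper filter has its preimage, or the complement of that preimage, in
    [F], and the second case would put both [B] and its complement in the
    larger filter. *)
Lemma fmap_ultra (T U : Type) (f : T -> U) (F : set_system T) :
  UltraFilter F -> UltraFilter (f @ F).
Proof.
move=> FU; split => [|G PG FG]; first exact: fmap_proper_filter.
apply/seteqP; split => // B GB.
have [//|FnB] := in_ultra_setVsetC (f @^-1` B) FU.
have GnB : G (~` B) by apply: FG.
exfalso; apply: (@filter_not_empty _ G PG).
by rewrite -(setICr B); exact: filterI.
Qed.

Lemma cvg_mulmx_entry (R : realType) (T : Type) (F : set_system T)
    (m n p : nat) (B : T -> 'M[R]_(m, n)) (C : T -> 'M[R]_(n, p))
    (B0 : 'M[R]_(m, n)) (C0 : 'M[R]_(n, p)) :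
  Filter F ->
  (forall i j, B t i j @[t --> F] --> B0 i j) ->
  (forall i j, C t i j @[t --> F] --> C0 i j) ->
  forall i j, (B t *m C t) i j @[t --> F] --> (B0 *m C0) i j.
Proof.
move=> FF BB0 CC0 i j; rewrite mxE; under eq_fun do rewrite mxE.
apply: cvg_big => [|k _]; first exact: add_continuous.
exact: cvgM.
Qed.

Lemma cvg_det_entry (R : realType) (T : Type) (F : set_system T)
    (m : nat) (B : T -> 'M[R]_m) (B0 : 'M[R]_m) :
  Filter F ->
  (forall i j, B t i j @[t --> F] --> B0 i j) ->
  \det (B t) @[t --> F] --> \det B0.
Proof.
move=> FF BB0; apply: cvg_big => [|s _]; first exact: add_continuous.
apply: cvgM; first exact: cvg_cst.
by apply: cvg_big => [|k _ //]; exact: mul_continuous.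
Qed.

(** * The two implications *)

(** The constant sequence works; its term is [P^T] because the two notions put
    the transpose on opposite sides. *)
Lemma SD_TWSD_B (R : realType) (L m : nat) (A : 'I_L -> 'M[R]_m) :
  SD A -> TWSD_B A.
Proof.
move=> [P detP diagP].
exists (fun=> P^T), (fun _ i => P^T *m A i *m P); split => //.
- by move=> _; rewrite /in_SL det_tr.
- rewrite trmxK; under eq_fun do under eq_bigr do rewrite subrr.
  rewrite big1 => [|i _]; first exact: cvg_cst.
  rewrite /frobenius_norm big1 ?sqrtr0 ?expr0n // => j _.
  by rewrite big1 // => l _; rewrite mxE expr0n.
- exists (\sum_i frobenius_norm (P^T *m A i *m P)) => _ i.
  by rewrite (bigD1 i) //= lerDl sumr_ge0 // => *; exact: frobenius_norm_ge0.
Qed.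

(** This is where positive definiteness enters.  The [(i, i)] entry of
    [P k *m S *m (P k)^T] is the value of the form [S = \sum_l a l *: A l] at
    row [i] of [P k].  It is also a fixed linear combination of the [(i, i)]
    entries of the congruent matrices, which are eventually within distance 1
    of the bounded entries of [D k l].  Hence the form is bounded along the
    rows of [P k], and so is each coordinate of these rows. *)
Lemma TWSD_B_entry_bounded (R : realType) (L m : nat) (A : 'I_L -> 'M[R]_m)
    (P : nat -> 'M[R]_m) (D : nat -> 'I_L -> 'M[R]_m) (M : R) :
  positive_definite A ->
  (fun k => \sum_(i < L)
     frobenius_norm (P k *m A i *m (P k)^T - D k i) ^+ 2) @ \oo --> (0 : R) ->
  (forall k i, frobenius_norm (D k i) <= M) ->
  forall i j, exists c : R, \forall k \near \oo, `|P k i j| <= c.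
Proof.
move=> [a pdS] cvgD DM i j; set S := \sum_(i < L) _ in pdS.
have [c cP] := posdefmx_coord_le j pdS.
exists (\sum_l `|a l| * (1 + M) + c).
have : \forall k \near \oo, \sum_(l < L)
    frobenius_norm (P k *m A l *m (P k)^T - D k l) ^+ 2 < 1.
  exact: (cvgr_lt _ cvgD _ ltr01).
apply: filterS => k sum1.
(* At indices where the sum of squared errors is below 1, each error is. *)
have entry l : `|(P k *m A l *m (P k)^T) i i| <= 1 + M.
  rewrite -[_ *m _](subrK (D k l)) mxE (le_trans (ler_normD _ _)) // lerD //.
    apply: (le_trans (frobenius_norm_entry _ _ _)).
    rewrite -(ler_pXn2r (n := 2)) ?nnegrE ?frobenius_norm_ge0 // expr1n.
    apply: le_trans (ltW sum1); rewrite (bigD1 l) //= lerDl.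
    by rewrite sumr_ge0 // => *; exact: sqr_ge0.
  exact: le_trans (frobenius_norm_entry _ _ _) (DM k l).
have := cP (row i (P k))^T; rewrite trmxK [_^T j 0]mxE [row _ _ _ _]mxE => xle.
have qE : (row i (P k) *m S *m (row i (P k))^T) 0 0
    = \sum_l a l * (P k *m A l *m (P k)^T) i i.
  rewrite tr_row -row_mul.
  transitivity ((P k *m S *m (P k)^T) i i).
    by rewrite !mxE; apply: eq_bigr => l _; rewrite !mxE.
  rewrite mulmx_sumr mulmx_suml summxE; apply: eq_bigr => l _.
  by rewrite -scalemxAr -scalemxAl mxE.
have qle : \sum_l a l * (P k *m A l *m (P k)^T) i i <= \sum_l `|a l| * (1 + M).
  apply: ler_sum => l _; apply: (le_trans (ler_norm _)).
  by rewrite normrM ler_wpM2l.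
rewrite qE mulr2n in xle.
have := normr_ge0 (P k i j); lra.
Qed.

(** The limit of the [P k] along an ultrafilter refining [\oo] plays the role
    of a subsequential limit and treats all entries at once, without successive
    extraction.  Determinants pass to the limit, and off-diagonal entries of
    the congruent matrices tend to 0, because there they agree with the
    entries of the difference with [D k l]. *)
Lemma TWSD_B_SD (R : realType) (L m : nat) (A : 'I_L -> 'M[R]_m) :
  positive_definite A -> TWSD_B A -> SD A.
Proof.
move=> pdA [P [D [detP diagD cvgD [M DM]]]].
have bnd := TWSD_B_entry_bounded pdA cvgD DM.
have [U [UU ooU]] := ultraFilterLemma (F := \oo) _.
have entry i j : exists q : R, P k i j @[k --> U] --> q.
  have [c Pc] := bnd i j.
  have := @segment_compact R (- c) c; rewrite compact_ultra.
  move=> /(_ (P k i j @[k --> U]) (fmap_ultra _ UU)) [|q [_ Pq]]; last by exists q.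
  apply: ooU; apply: filterS Pc => k /=.
  by rewrite in_itv /= ler_norml.
pose Q : 'M[R]_m := \matrix_(i, j) sval (cid (entry i j)).
have PQ i j : P k i j @[k --> U] --> Q i j.
  by rewrite mxE; exact: svalP (cid (entry i j)).
exists Q^T.
  rewrite /in_SL det_tr.
  have : \det (P k) @[k --> U] --> \det Q by exact: cvg_det_entry.
  under eq_fun do rewrite detP.
  by move=> detQ; exact: (cvg_unique _ detQ (cvg_cst _)).
move=> l; apply/is_diag_mxP => i j ij; rewrite trmxK.
have congr_cvg : (P k *m A l *m (P k)^T) i j @[k --> U] --> (Q *m A l *m Q^T) i j.
  apply: cvg_mulmx_entry => [|u v].
    by apply: cvg_mulmx_entry => // u v; exact: cvg_cst.
  by rewrite [Q^T u v]mxE; under eq_fun do rewrite mxE; exact: PQ.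
(* Squares, since the hypothesis bounds the squared Frobenius norm. *)
have sqr_cvg0 : (P k *m A l *m (P k)^T) i j ^+ 2 @[k --> U] --> (0 : R).
  suff oo_cvg0 : (P k *m A l *m (P k)^T) i j ^+ 2 @[k --> \oo] --> (0 : R).
    by move=> B /oo_cvg0; exact: ooU.
  apply: (squeeze_cvgr _ (cvg_cst 0) cvgD); apply: nearW => k.
  rewrite sqr_ge0 /=.
  have -> : (P k *m A l *m (P k)^T) i j = (P k *m A l *m (P k)^T - D k l) i j.
    rewrite [RHS]mxE [X in _ + X]mxE.
    by rewrite (is_diag_mxP (diagD k l) i j ij) subr0.
  apply: (le_trans (frobenius_norm_sqr_entry _ _ _)).
  by rewrite (bigD1 l) //= lerDl sumr_ge0 // => *; exact: sqr_ge0.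
have sqr_cvg : (P k *m A l *m (P k)^T) i j ^+ 2 @[k --> U]
    --> (Q *m A l *m Q^T) i j ^+ 2 by exact: (cvgM congr_cvg congr_cvg).
apply/eqP; rewrite -sqrf_eq0; apply/eqP.
exact: (cvg_unique _ sqr_cvg sqr_cvg0).
Qed.

Theorem theorem3p10 (R : realType) (L m : nat) (A : 'I_L -> 'M[R]_m)
    (symA : forall i : 'I_L, A i \is symmetricmx)
    (pdA : positive_definite A) :
  TWSD_B A <-> SD A.
Proof.
by split; [exact: TWSD_B_SD | exact: SD_TWSD_B].
Qed.
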